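(* Let $A$ be a unital $C^*$-algebra and $x\in A$. The following conditions are equivalent: (i) $x\in(A_q^{-1})^{=}$, the norm closure of $A_q^{-1}$ in $A$; (ii) $x\in\operatorname{cl}(A_q^{-1})$.
   Context: For elements $s,t\in A$ write $s\perp t$ if $sAt=0=tAs$. $u\in A$ is quasi-invertible, $u\in A_q^{-1}$, if there exist $c,d\in A$ with $(1-uc)\perp(1-du)$. $\operatorname{cl}(A_q^{-1})$ is the set of $a\in A$ such that whenever $za+b=1$ for some $z,b\in A$, there is $y\in A$ with $a+yb\in A_q^{-1}$. ($A$ is called a $QB$-ring if $\operatorname{cl}(A_q^{-1})=A$, and extremally rich if $(A_q^{-1})^{=}=A$.) *)

(* Defs.v *)
From HB Require Import structures.
From mathcomp Require Import all_boot all_order all_algebra.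
From mathcomp Require Import complex.
From mathcomp Require Import classical_sets reals topology normedtype.

Set Implicit Arguments.
Unset Strict Implicit.
Unset Printing Implicit Defensive.

Import Order.TTheory GRing.Theory Num.Theory.
Import numFieldNormedType.Exports.

Local Open Scope classical_set_scope.
Local Open Scope ring_scope.

(* Unital complex C*-algebras.  HB does not accept a structure inheriting from
   both [NormedModule] and [GRing.PzRing] (their join would have to be declared
   before [Num.NumDomain]), so the product and the unit are fields of the mixin
   and the ring structure is put on the carrier afterwards.  The zero algebra
   is not excluded: 1 != 0 is not assumed.  As in every normed module over
   R[i], the norm takes its values in the nonnegative reals seen inside R[i]. *)
HB.mixin Record isCStarAlgebra (R : realType) A
    & CompleteNormedModule R[i] A := {
  cstar_one : A;
  cstar_mul : A -> A -> A;
  star : A -> A;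
  cstar_mulA : associative cstar_mul;
  cstar_mul1 : left_id cstar_one cstar_mul;
  cstar_mulr1 : right_id cstar_one cstar_mul;
  cstar_mulDl : left_distributive cstar_mul +%R;
  cstar_mulDr : right_distributive cstar_mul +%R;
  cstar_scaleAl : forall (k : R[i]) (x y : A),
    k *: cstar_mul x y = cstar_mul (k *: x) y;
  cstar_scaleAr : forall (k : R[i]) (x y : A),
    k *: cstar_mul x y = cstar_mul x (k *: y);
  cstar_norm_mul : forall x y : A, `|cstar_mul x y| <= `|x| * `|y|;
  starK : involutive star;
  starD : {morph star : x y / x + y};
  starZ : forall (k : R[i]) (x : A), star (k *: x) = Num.conj k *: star x;
  cstar_star_mul : forall x y : A,
    star (cstar_mul x y) = cstar_mul (star y) (star x);
  cstar_norm_star : forall x : A, `|cstar_mul (star x) x| = `|x| ^+ 2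
}.

#[short(type="cstarAlgType")]
HB.structure Definition CStarAlgebra (R : realType) :=
  {A of CompleteNormedModule R[i] A & isCStarAlgebra R A}.

HB.instance Definition _ (R : realType) (A : cstarAlgType R) :=
  GRing.Zmodule_isPzRing.Build (CStarAlgebra.sort A)
    cstar_mulA cstar_mul1 cstar_mulr1 cstar_mulDl cstar_mulDr.

Section CStarAlgebraTheory.
Context {R : realType} {A : cstarAlgType R}.
Implicit Types (k : R[i]) (x y : A).

Lemma cstar_scalerAl k x y : k *: (x * y) = (k *: x) * y.
Proof. exact: cstar_scaleAl. Qed.

Lemma cstar_scalerAr k x y : k *: (x * y) = x * (k *: y).
Proof. exact: cstar_scaleAr. Qed.

Lemma cstar_ler_normM x y : `|x * y| <= `|x| * `|y|.
Proof. exact: cstar_norm_mul. Qed.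

Lemma starM x y : star (x * y) = star y * star x.
Proof. exact: cstar_star_mul. Qed.

Lemma normr_starM x : `|star x * x| = `|x| ^+ 2.
Proof. exact: cstar_norm_star. Qed.

End CStarAlgebraTheory.

Definition ring_perp (A : pzRingType) (s t : A) : Prop :=
  (forall a : A, s * a * t = 0) /\ (forall a : A, t * a * s = 0).

Definition quasi_invertible (A : pzRingType) : set A :=
  [set u | exists c d : A, ring_perp (1 - u * c) (1 - d * u)].
Arguments quasi_invertible A : clear implicits.

(* The algebraic operation cl, not to be confused with the topological
   [closure]. *)
Definition ring_cl (A : pzRingType) (S : set A) : set A :=
  [set a | forall z b : A, z * a + b = 1 -> exists y : A, S (a + y * b)].

(* Main.v *)
Require Import Defs.
From mathcomp Require Import all_boot all_order all_algebra.
From mathcomp Require Import complex ring lra.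
From mathcomp Require Import classical_sets reals topology normedtype.

(* If x is close to a quasi-invertible u and z x + b = 1, then
   u = (1 - (x - u) z) x - (x - u) b, where 1 - (x - u) z is invertible by the
   Neumann series; quasi-invertibility is stable under multiplication by
   invertible elements.

   Conversely, choose z x + b = 1 with b = s_-, the negative part of a
   self-adjoint s, function of x^* x, which is close to 1 except where |x| is
   small. Given y with u = x + y b quasi-invertible, u k is close to x for the
   invertible k = (t + s_+) (1 + s_-)^-1 with t small: x k is close to x, and
   b k = t s_- (1 + s_-)^-1 is as small as desired, whatever the norm of y.

   No spectral theory is needed. For h self-adjoint, the identity
   r - r^* = -2 t i r^* r for r = (h + t i)^-1 gives |r| <= 1/t, so that
   invertibility at t propagates from large t to all t > 0. Then
   s = (h^2 - 1)/(h^2 + 1) and v = 2 h/(h^2 + 1) satisfy s^2 + v^2 = 1, so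
   |v| <= 1, and iterating r |-> (v^2 + r^2)/2 yields 1 - r = |s|. *)

Set Implicit Arguments.
Unset Strict Implicit.
Unset Printing Implicit Defensive.

Import Order.TTheory GRing.Theory Num.Theory.
Import numFieldNormedType.Exports.

Local Open Scope classical_set_scope.
Local Open Scope ring_scope.
Local Open Scope complex_scope.

(** * Real-valued norm and dominated iteration *)

Section CStarNorm.
Context {R : realType} {A : cstarAlgType R}.
Implicit Types (k : R[i]) (t e : R) (a b c l u w x y : A).

(** The norm takes values in [R[i]]; its real part carries the same information in the ordered field
    [R], where [lra] and [nra] apply. *)
Definition rnorm a : R := complex.Re `|a|.

Lemma rnormE a : `|a| = (rnorm a)%:C.
Proof. by rewrite /rnorm RRe_real // ger0_real. Qed.

Lemma rnorm_ge0 a : 0 <= rnorm a.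
Proof. by rewrite -ler0c -rnormE. Qed.

Lemma rnormD a b : rnorm (a + b) <= rnorm a + rnorm b.
Proof. by rewrite -lecR rmorphD /= -!rnormE ler_normD. Qed.

Lemma rnormM a b : rnorm (a * b) <= rnorm a * rnorm b.
Proof. by rewrite -lecR rmorphM /= -!rnormE cstar_ler_normM. Qed.

Lemma rnormN a : rnorm (- a) = rnorm a.
Proof. by rewrite /rnorm normrN. Qed.

Lemma rnormB a b : rnorm (a - b) <= rnorm a + rnorm b.
Proof. by rewrite -(rnormN b) rnormD. Qed.

Lemma rnorm_distC a b : rnorm (a - b) = rnorm (b - a).
Proof. by rewrite -rnormN opprB. Qed.

Lemma rnorm0 : rnorm 0 = 0.
Proof. by rewrite /rnorm normr0. Qed.

Lemma rnorm_eq0 a : rnorm a <= 0 -> a = 0.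
Proof.
move=> a0; apply/eqP; rewrite -normr_eq0 rnormE.
by rewrite (le_anti (_ : rnorm a <= 0 <= rnorm a)) // a0 rnorm_ge0.
Qed.

Lemma rnormZ k a : rnorm (k *: a) = complex.Re `|k| * rnorm a.
Proof.
have kE : `|k| = (complex.Re `|k|)%:C by rewrite RRe_real ?normr_real.
by apply: (@complexI R); rewrite rmorphM /= -/(rnorm _) -!rnormE normrZ {1}kE.
Qed.

Lemma rnormZr t a : rnorm (t%:C *: a) = `|t| * rnorm a.
Proof. by rewrite rnormZ normc_def /= expr0n addr0 sqrtr_sqr. Qed.

Lemma star0 : star (0 : A) = 0.
Proof. by apply: (addrI (star 0)); rewrite -starD !addr0. Qed.

Lemma starN a : star (- a) = - star a.
Proof. by apply/eqP; rewrite -subr_eq0 opprK -starD addNr star0. Qed.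

Lemma starB a b : star (a - b) = star a - star b.
Proof. by rewrite starD starN. Qed.

Lemma star1 : star (1 : A) = 1.
Proof. by have := starM (star 1) (1 : A); rewrite starK !mulr1 starK => <-. Qed.

Lemma starZr t a : star (t%:C *: a) = t%:C *: star a.
Proof. by rewrite starZ; congr (_ *: _); apply/CrealP; rewrite complex_real. Qed.

Lemma rnorm_starM a : rnorm (star a * a) = rnorm a ^+ 2.
Proof.
by apply: (@complexI R); rewrite rmorphXn /= -!rnormE normr_starM.
Qed.

Lemma rnorm_star a : rnorm (star a) = rnorm a.
Proof.
suff le b : rnorm b <= rnorm (star b).
  by apply/le_anti; rewrite -{2}(starK a) !le.
have := rnormM (star b) b; rewrite rnorm_starM => h.
have := rnorm_ge0 b; have := rnorm_ge0 (star b); nra.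
Qed.

(** Only an inequality, because 1 = 0 in the zero algebra. *)
Lemma rnorm1 : rnorm 1 <= 1.
Proof.
have := rnorm_starM 1; rewrite star1 mulr1.
have := rnorm_ge0 1; nra.
Qed.

(** The increments are dominated by those of [rho], which is nondecreasing and bounded, so the
    iterates are Cauchy; the Lipschitz bound at the limit makes it a fixed point. Commutation with
    all iterates passes to the limit. *)
Lemma dominated_fixpoint (F : A -> A) (rho : nat -> R) (M : R) :
  rho 0%N = 0 -> (forall n, rho n <= M) ->
  (forall n, rnorm (iter n.+1 F 0 - iter n F 0) <= rho n.+1 - rho n) ->
  (forall l, exists C, forall n,
     rnorm (F l - F (iter n F 0)) <= C * rnorm (l - iter n F 0)) ->
  exists l, [/\ F l = l, rnorm l <= M &
    forall c, (forall u, c * u = u * c -> c * F u = F u * c) -> c * l = l * c].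
Proof.
move=> rho0 rhoM dF lipF; set u := fun n => iter n F 0.
have dist n m : rnorm (u (n + m)%N - u n) <= rho (n + m)%N - rho n.
  elim: m => [|m IH]; first by rewrite addn0 !subrr rnorm0.
  rewrite addnS.
  have -> : u (n + m).+1 - u n =
      (u (n + m).+1 - u (n + m)%N) + (u (n + m)%N - u n).
    by rewrite addrA subrK.
  have := rnormD (u (n + m).+1 - u (n + m)%N) (u (n + m)%N - u n).
  have := dF (n + m)%N; rewrite -!/(u _); lra.
have mono n m : (n <= m)%N -> rho n <= rho m.
  move=> /subnKC <-; have := dist n (m - n)%N.
  have := rnorm_ge0 (u (n + (m - n))%N - u n); lra.
have [s [sM cvs]] : exists s, s <= M /\ forall e, 0 < e -> exists n,
  s - e < rho n /\ forall m, rho m <= s.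
  have ne : has_sup (range rho).
    by split; [exists (rho 0%N), 0%N | exists M => _ [n _ <-]].
  exists (sup (range rho)); split.
    by apply: ge_sup => [|_ [n _ <-]] //; case: ne.
  move=> e e0; have [_ [n _ <-] h] := sup_adherent e0 ne.
  by exists n; split => // m; apply: sup_upper_bound => //; exists m.
have small e : 0 < e -> exists n, forall m, (n <= m)%N -> rnorm (u n - u m) < e.
  move=> e0; have [n [hn hs]] := cvs _ e0; exists n => m nm.
  have := dist n (m - n)%N; rewrite subnKC // rnorm_distC.
  by have := hs m; lra.
(* Two consecutive indices are controlled together, since [F] sends [u n] to [u n.+1]. *)
have [l ul] : exists l, forall e, 0 < e -> exists2 n,
  rnorm (l - u n) < e & rnorm (l - u n.+1) < e.
  have /cauchy_cvg/cvg_ex[l ul] : cauchy (u @ \oo).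
    apply: cauchy_exP => eps eps0.
    have epsE : eps = (complex.Re eps)%:C by rewrite RRe_real ?gtr0_real.
    have /small[n hn] : 0 < complex.Re eps by rewrite -ltcR -epsE.
    exists (u n); exists n => // m /= nm.
    by rewrite -ball_normE /= epsE rnormE ltcR hn.
  exists l => e e0.
  have /cvgrPdist_lt/(_ e%:C) := ul; rewrite ltcR => /(_ e0)[n _ hn].
  by exists n; rewrite -ltcR -rnormE hn //=.
have vanish a C : (forall n,
  rnorm a <= C * (rnorm (l - u n) + rnorm (l - u n.+1))) -> a = 0.
  move=> aC; apply: rnorm_eq0; rewrite leNgt; apply/negP => a0.
  (* The sign of [C] is unknown, so |C| + 1 replaces it. *)
  have C1 : 0 < `|C| + 1 by have := normr_ge0 C; lra.
  have [n h1 h2] := ul (rnorm a / (`|C| + 1) / 2) ltac:(by rewrite !divr_gt0).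
  have := aC n; apply/negP; rewrite -ltNge.
  set x := rnorm (l - u n) + _; have x0 : 0 <= x by rewrite addr_ge0 ?rnorm_ge0.
  have xlt : x < rnorm a / (`|C| + 1) by rewrite /x; lra.
  move: xlt; rewrite ltr_pdivlMr //; have := ler_norm C; nra.
exists l; split.
- have [C hC] := lipF l; apply/eqP; rewrite -subr_eq0; apply/eqP.
  apply: (vanish _ (`|C| + 1)) => n.
  have -> : F l - l = (F l - F (u n)) - (l - u n.+1).
    by rewrite [u n.+1]/u /= opprB addrA subrK.
  have := rnormB (F l - F (u n)) (l - u n.+1); have := hC n; rewrite -/(u n).
  have := rnorm_ge0 (l - u n); have := rnorm_ge0 (l - u n.+1).
  have := normr_ge0 C; have := ler_norm C; nra.
- apply/ler_addgt0Pr => e e0; have [n h _] := ul e e0.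
  have := dist 0%N n; rewrite add0n subr0 rho0 subr0; have := rhoM n.
  by have := rnormD (l - u n) (u n); rewrite subrK; lra.
- move=> c cF; have cu n : c * u n = u n * c.
    by elim: n => [|n IH]; rewrite ?mulr0 ?mul0r // /u iterS cF.
  apply/eqP; rewrite -subr_eq0; apply/eqP; apply: (vanish _ (2 * rnorm c)) => n.
  have -> : c * l - l * c = c * (l - u n) - (l - u n) * c.
    by rewrite mulrBr mulrBl cu opprB addrA subrK.
  have := rnormB (c * (l - u n)) ((l - u n) * c).
  have := rnormM c (l - u n); have := rnormM (l - u n) c.
  have := rnorm_ge0 (l - u n.+1); have := rnorm_ge0 c; nra.
Qed.

End CStarNorm.

(** * Two-sided inverses and quasi-invertibility *)

Definition inverse_of (A : pzRingType) (a b : A) : Prop := a * b = 1 /\ b * a = 1.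

Section Inverse.
Context {A : pzRingType}.
Implicit Types a b c u v : A.

Lemma inverse_ofM a b c d :
  inverse_of a b -> inverse_of c d -> inverse_of (a * c) (d * b).
Proof.
move=> [ab ba] [cd dc]; split.
  by rewrite mulrA -(mulrA a) cd mulr1.
by rewrite mulrA -(mulrA d) ba mulr1.
Qed.

Lemma inverse_of_sym a b : inverse_of a b -> inverse_of b a.
Proof. by case. Qed.

Lemma inverse_of_comm a b c : inverse_of a b -> c * a = a * c -> c * b = b * c.
Proof.
move=> [ab ba] ca.
by rewrite -[c * b]mul1r -ba -!mulrA (mulrA a c) -ca -(mulrA c) ab mulr1.
Qed.

(** With [k' * c] and [k' * d] as witnesses, 1 - u c is unchanged and 1 - d u is conjugated by [k],
    which preserves orthogonality. *)
Lemma quasi_invertibleMr u k k' : inverse_of k k' ->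
  quasi_invertible A u -> quasi_invertible A (u * k).
Proof.
move=> [kk' k'k] [c [d [h1 h2]]]; exists (k' * c), (k' * d).
have -> : 1 - u * k * (k' * c) = 1 - u * c by rewrite mulrA -(mulrA u) kk' mulr1.
have -> : 1 - k' * d * (u * k) = k' * (1 - d * u) * k.
  by rewrite mulrBr mulr1 mulrBl k'k !mulrA.
split=> a; first by rewrite !mulrA -(mulrA _ a) h1 mul0r.
by transitivity (k' * ((1 - d * u) * (k * a) * (1 - u * c)));
  [rewrite !mulrA | rewrite h2 mulr0].
Qed.

Lemma quasi_invertibleMl u v v' : inverse_of v v' ->
  quasi_invertible A u -> quasi_invertible A (v * u).
Proof.
move=> [vv' v'v] [c [d [h1 h2]]]; exists (c * v'), (d * v').
have -> : 1 - d * v' * (v * u) = 1 - d * u by rewrite mulrA -(mulrA d) v'v mulr1.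
have -> : 1 - v * u * (c * v') = v * (1 - u * c) * v'.
  by rewrite mulrBr mulr1 mulrBl vv' !mulrA.
split=> a.
  by transitivity (v * ((1 - u * c) * (v' * a) * (1 - d * u)));
    [rewrite !mulrA | rewrite h1 mulr0].
by rewrite !mulrA -(mulrA _ a) h2 mul0r.
Qed.

End Inverse.

(** * Neumann series and square roots *)

Section Resolvent.
Context {R : realType} {A : cstarAlgType R}.
Implicit Types (k : R[i]) (t e : R) (a b c l u w x y : A).

(** The inverse is the fixed point of u |-> (1 + w u) / t, whose iterates from 0 are the partial
    sums of the Neumann series. *)
Lemma neumann t w : rnorm w < t ->
  exists2 b, inverse_of (t%:C *: (1 : A) - w) b & rnorm b <= (t - rnorm w)^-1.
Proof.
move=> wt; have w0 := rnorm_ge0 w; set q := rnorm w / t.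
have t0 : 0 < t by lra.
have q0 : 0 <= q by rewrite divr_ge0 // ltW.
have q1 : q < 1 by rewrite ltr_pdivrMr // mul1r.
pose F u : A := t^-1%:C *: (1 + w * u).
have FB u v : F u - F v = t^-1%:C *: (w * (u - v)).
  by rewrite /F -scalerBr mulrBr opprD addrACA subrr add0r.
have FN u v : rnorm (F u - F v) <= q * rnorm (u - v).
  rewrite FB rnormZr gtr0_norm ?invr_gt0 // /q mulrAC mulrC -ler_pdivlMr
    ?invr_gt0 //.
  by rewrite invrK mulfVK ?gt_eqF // rnormM.
have dF n : rnorm (iter n.+1 F 0 - iter n F 0) <= q ^+ n / t.
  elim: n => [|n IH].
    rewrite /= subr0 /F mulr0 addr0 rnormZr gtr0_norm ?invr_gt0 // expr0 mul1r.
    by rewrite ler_piMr ?invr_ge0 ?rnorm1 // ltW.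
  rewrite !iterS; apply: le_trans (FN _ _) _; rewrite exprS -mulrA.
  by rewrite ler_wpM2l.
(* The majorant is the partial sum of the geometric series of q^k / t, whose limit is 1 / (t -
   |w|). *)
have [||||l [Fl lM lc]] := @dominated_fixpoint _ _ F
  (fun n => (1 - q ^+ n) / (t - rnorm w)) (t - rnorm w)^-1.
- by rewrite expr0 subrr mul0r.
- by move=> n; rewrite ler_piMl ?gerBl ?exprn_ge0 // invr_ge0 subr_ge0 ltW.
- move=> n; apply: le_trans (dF n) _; rewrite -mulrBl.
  have -> : 1 - q ^+ n.+1 - (1 - q ^+ n) = q ^+ n * (1 - q).
    by rewrite exprSr; ring.
  suff -> : (1 - q) = (t - rnorm w) / t.
    rewrite -!mulrA ler_wpM2l ?exprn_ge0 // [t^-1 * _]mulrC mulVKf //.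
    by rewrite subr_eq0 gt_eqF.
  by rewrite mulrBl divff ?gt_eqF.
- by move=> l; exists q => n; apply: FN.
have tl : t%:C *: l = 1 + w * l.
  by rewrite -{1}Fl /F scalerA -rmorphM /= divff ?gt_eqF // scale1r.
exists l => //; split; first by rewrite mulrBl -cstar_scalerAl mul1r tl addrK.
(* The inverse is two-sided because [l], as a limit of iterates, commutes with [w]. *)
rewrite mulrBr -cstar_scalerAr mulr1 tl -lc ?addrK // => u wu.
by rewrite /F -cstar_scalerAr -cstar_scalerAl mulrDr mulrDl mulr1 mul1r -mulrA
  -wu.
Qed.

Lemma half_scaleD a : (2^-1)%:C *: a + (2^-1)%:C *: a = a.
Proof.
rewrite -scalerDl -rmorphD /=; have -> : 2^-1 + 2^-1 = 1 :> R by field.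
by rewrite scale1r.
Qed.

(** (1 - r)^2 = 1 - w amounts to the fixed-point equation r = (w + r^2) / 2. On the unit ball the
    Lipschitz bound of [F] is only 1, so convergence comes from a scalar majorant and not from
    contraction. *)
Lemma sqrt_one_sub w : rnorm w <= 1 ->
  exists r, [/\ (1 - r) * (1 - r) = 1 - w, rnorm r <= 1 &
    forall c, c * w = w * c -> c * r = r * c].
Proof.
move=> w1; pose F u : A := (2^-1)%:C *: (w + u * u).
(* The iterates of F are majorized by those of f, the scalar case w = 1. *)
pose f (s : R) : R := (1 + s ^+ 2) / 2; pose rho n := iter n f 0.
have rhoS n : rho n.+1 = f (rho n) by [].
have rho01 n : 0 <= rho n <= 1.
  by elim: n => [|n IH]; [rewrite /rho /= lexx ler01 | rewrite rhoS /f; nra].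
have FB u v : F u - F v = (2^-1)%:C *: (u * (u - v) + (u - v) * v).
  by rewrite /F -scalerBr mulrBr mulrBl addrA subrK opprD addrACA subrr add0r.
have FN u v : rnorm (F u - F v) <= (rnorm u + rnorm v) / 2 * rnorm (u - v).
  rewrite FB rnormZr gtr0_norm ?invr_gt0 //.
  have := rnormD (u * (u - v)) ((u - v) * v).
  by have := rnormM u (u - v); have := rnormM (u - v) v; lra.
have FN1 u : rnorm (F u) <= f (rnorm u).
  rewrite /F rnormZr gtr0_norm ?invr_gt0 // /f.
  by have := rnormD w (u * u); have := rnormM u u; lra.
have uN n : rnorm (iter n F 0) <= rho n.
  elim: n => [|n IH]; first by rewrite rnorm0.
  rewrite iterS; apply: le_trans (FN1 _) _; rewrite rhoS /f.
  by have := rnorm_ge0 (iter n F 0); nra.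
have dF n : rnorm (iter n.+1 F 0 - iter n F 0) <= rho n.+1 - rho n.
  elim: n => [|n IH].
    by have := uN 1; rewrite /= !subr0.
  rewrite !iterS; apply: le_trans (FN _ _) _.
  (* The scalar increment factors exactly like the bound [FN]. *)
  have -> : rho n.+2 - rho n.+1 = (rho n.+1 + rho n) / 2 * (rho n.+1 - rho n).
    by rewrite rhoS {2}rhoS /f (rhoS n) /f; field.
  have h1 := uN n.+1; have h2 := uN n; apply: ler_pM => //; rewrite ?rnorm_ge0 //.
    by rewrite divr_ge0 ?addr_ge0 ?rnorm_ge0.
  by rewrite ler_pM2r ?invr_gt0 // lerD.
have [||||r [Fr r1 rc]] := @dominated_fixpoint _ _ F rho 1.
- by [].
- by move=> n; have /andP[] := rho01 n.
- exact: dF.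
- move=> l; exists ((rnorm l + 1) / 2) => n; apply: le_trans (FN _ _) _.
  rewrite ler_wpM2r ?rnorm_ge0 // ler_pM2r ?invr_gt0 // lerD2l.
  by apply: le_trans (uN n) _; have /andP[] := rho01 n.
exists r; split => //.
  have rr : r + r = w + r * r by rewrite -{1 2}Fr /F half_scaleD.
  have -> : w = r + r - r * r by rewrite rr addrK.
  by rewrite mulrBr mulr1 mulrBl mul1r !opprB opprD !addrA (addrAC 1).
move=> c cw; apply: rc => u cu.
by rewrite /F -cstar_scalerAr -cstar_scalerAl mulrDr mulrDl cw mulrA cu -mulrA
  cu mulrA.
Qed.

End Resolvent.

(** * Resolvents of self-adjoint elements *)

Section SelfAdjoint.
Context {R : realType} {A : cstarAlgType R}.
Implicit Types (k : R[i]) (t e : R) (a b c h l u w x y : A).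

Definition iunit : A := 'i%R *: (1 : A).

Lemma iunit2 : iunit * iunit = - 1.
Proof.
by rewrite /iunit -cstar_scalerAr mulr1 scalerA -expr2 sqrCi scaleN1r.
Qed.

Lemma iunitC a : iunit * a = a * iunit.
Proof. by rewrite /iunit -cstar_scalerAr -cstar_scalerAl mulr1 mul1r. Qed.

Lemma star_iunit : star iunit = - iunit.
Proof. by rewrite /iunit starZ star1 conjCi scaleNr. Qed.

Lemma rnorm_iunit : rnorm iunit <= 1.
Proof.
have := rnorm_starM iunit; rewrite star_iunit mulNr iunit2 opprK.
by have := rnorm1 (A := A); have := rnorm_ge0 iunit; nra.
Qed.

Lemma rnorm_iunitM a : rnorm (iunit * a) <= rnorm a.
Proof.
apply: le_trans (rnormM _ _) _; rewrite ler_piMl ?rnorm_ge0 //.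
exact: rnorm_iunit.
Qed.

(* From r^* (z^* - z) r = r - r^*, where z = h + t i. *)
Lemma resolvent_bound h t r : star h = h -> 0 < t ->
  inverse_of (h + t%:C *: iunit) r -> rnorm r <= t^-1.
Proof.
move=> hh t0 [zr rz]; set z := h + _ in zr rz.
have zE : star z = z - (2 * t)%:C *: iunit.
  rewrite starD hh starZr star_iunit scalerN rmorphM /= -scalerA.
  have -> : (2 : R)%:C *: (t%:C *: iunit) = t%:C *: iunit + t%:C *: iunit.
    by rewrite rmorph_nat scaler_nat mulr2n.
  by rewrite /z opprD addrA addrK.
have rr : (2 * t)%:C *: (star r * iunit * r) = star r - r.
  have : star r * star z * r = r by rewrite -starM zr star1 mul1r.
  rewrite zE mulrBr -cstar_scalerAr mulrBl -mulrA zr mulr1 -cstar_scalerAl => e.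
  by rewrite -[X in _ - X]e opprB addrC subrK.
have {}rr : (2 * t)%:C *: (star r * r) = - (iunit * (star r - r)).
  rewrite -rr -cstar_scalerAr !mulrA iunitC -(mulrA (star r)) iunit2 mulrN1.
  by rewrite mulNr scalerN opprK.
(* The C*-identity and |i| <= 1 turn [rr] into this bound. *)
have : 2 * t * rnorm r ^+ 2 <= 2 * rnorm r.
  rewrite -rnorm_starM -[X in X * _](gtr0_norm (_ : 0 < 2 * t)) -?rnormZr;
    last lra.
  rewrite rr rnormN; apply: le_trans (rnorm_iunitM _) _.
  by apply: le_trans (rnormB _ _) _; rewrite rnorm_star; lra.
have := rnorm_ge0 r; rewrite -[t^-1]mul1r ler_pdivlMr //; nra.
Qed.

(** As the resolvent at s has norm at most 1/s, invertibility at s reaches every u with |u - s| < s,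
    in particular s/2. Repeated halving descends from above |h| to t. *)
Lemma add_iunit_invertible h t : star h = h -> 0 < t ->
  exists r, inverse_of (h + t%:C *: iunit) r.
Proof.
move=> hh.
have step (s u : R) : 0 < s -> `|u - s| < s ->
    (exists r, inverse_of (h + s%:C *: iunit) r) ->
    exists r, inverse_of (h + u%:C *: iunit) r.
  move=> s0 us [r hr]; have rs := resolvent_bound hh s0 hr.
  pose w := (s - u)%:C *: (r * iunit).
  have w1 : rnorm w < 1.
    rewrite /w rnormZr distrC -iunitC.
    have : `|u - s| * rnorm r < 1.
      (* In the zero algebra |r| = 0, and a strict bound cannot be multiplied by it. *)
      have [/eqP ->|r0] := boolP (rnorm r == 0); first by rewrite mulr0.
      apply: lt_le_trans (_ : s * rnorm r <= _).
        by rewrite ltr_pM2r // lt_neqAle eq_sym r0 rnorm_ge0.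
      by rewrite mulrC -ler_pdivlMr // mul1r.
    by have := rnorm_iunitM r; have := normr_ge0 (u - s); nra.
  have [b hb _] := neumann w1; exists (b * r).
  have -> : h + u%:C *: iunit = (h + s%:C *: iunit) * (1%:C *: (1 : A) - w).
    case: hr => zr _;
      rewrite scale1r mulrBr mulr1 /w -cstar_scalerAr mulrA zr mul1r.
    by rewrite -addrA -scalerBl -rmorphB /=; congr (_ + _%:C *: _); ring.
  exact: inverse_ofM.
move=> t0.
(* Here h + s i = i (s - i h), and the Neumann series applies. *)
have big (s : R) : rnorm h < s -> exists r, inverse_of (h + s%:C *: iunit) r.
  move=> hs; have s0 : 0 < s by have := rnorm_ge0 h; lra.
  have jh : rnorm (iunit * h) < s by apply: le_lt_trans hs; apply: rnorm_iunitM.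
  have [b hb _] := neumann jh; exists (b * - iunit).
  have -> : h + s%:C *: iunit = iunit * (s%:C *: (1 : A) - iunit * h).
    by rewrite mulrBr mulrA iunit2 mulN1r opprK -cstar_scalerAr mulr1 addrC.
  by apply: inverse_ofM => //; split; rewrite ?mulrN ?mulNr iunit2 opprK.
have [n hn] : exists n, rnorm h < 2 ^+ n * t.
  have ht : 0 <= rnorm h / t by rewrite divr_ge0 ?rnorm_ge0 ?ltW.
  exists (Num.bound (rnorm h / t)); rewrite -ltr_pdivrMr //.
  apply: lt_trans (archi_boundP ht) _.
  by rewrite -natrX ltr_nat ltn_expl.
elim: n t t0 hn => [|n IH] t t0; first by rewrite expr0 mul1r => /big.
rewrite exprSr -mulrA => /IH h2t; apply: (step (2 * t)); [lra| |apply: h2t; lra].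
by rewrite ltr_norml; apply/andP; split; lra.
Qed.

(** 1 + h^2 is the product of h + i and its adjoint h - i, so one resolvent inverts both factors. *)
Lemma add1_sqr_invertible h : star h = h -> exists g, inverse_of (1 + h * h) g.
Proof.
move=> hh; have [r [zr rz]] := add_iunit_invertible hh (ltr01 : 0 < (1 : R)).
rewrite scale1r in zr rz; exists (star r * r).
have -> : 1 + h * h = (h + iunit) * (h - iunit).
  by rewrite mulrBr !mulrDl iunit2 (iunitC h) opprD opprK !addrA addrK addrC.
apply: inverse_ofM => //; rewrite -star_iunit -{1}hh -starD.
by split; rewrite -starM ?rz ?zr star1.
Qed.

(** For z = a + i b, [star z * z] is 1, hence |z| <= 1, and a is the average of z and its
    adjoint. *)
Lemma rnorm_sqrD1 a b : star a = a -> star b = b -> a * b = b * a ->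
  a * a + b * b = 1 -> rnorm a <= 1.
Proof.
move=> ha hb ab sq; pose z := a + iunit * b.
have zE : star z = a - iunit * b by
  rewrite starD ha starM hb star_iunit mulrN -iunitC.
have z1 : rnorm z <= 1.
  have := rnorm_starM z; rewrite zE /z mulrBl !mulrDr.
  rewrite (mulrA a) -iunitC -!mulrA ab (mulrA b) -iunitC -mulrA.
  rewrite (mulrA iunit iunit) iunit2 mulN1r opprD opprK addrA addrK sq => e.
  by have := rnorm1 (A := A); have := rnorm_ge0 z; nra.
have -> : a = (2^-1)%:C *: (z + star z).
  by rewrite zE /z addrACA subrr addr0 scalerDr half_scaleD.
rewrite rnormZr gtr0_norm ?invr_gt0 //.
by have := rnormD z (star z); rewrite rnorm_star; lra.
Qed.

End SelfAdjoint.

(** * Orthogonal parts and the cutoff *)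

Section Parts.
Context {R : realType} {A : cstarAlgType R}.
Implicit Types (t e : R) (a b c d h l m p s u v w x y : A).

(* Orthogonality gives p (t + p + m) = p (t + p) = (t + p) p. *)
Lemma inverse_of_scalar_addl t p m d : 0 < t -> p * m = 0 -> m * p = 0 ->
  inverse_of (t%:C *: (1 : A) + (p + m)) d ->
  inverse_of (t%:C *: (1 : A) + p) (t^-1%:C *: (1 - p * d)).
Proof.
move=> t0 pm mp hd; set z := t%:C *: (1 : A) + p.
have pz : p * (t%:C *: (1 : A) + (p + m)) = p * z by rewrite !mulrDr pm addr0.
have zp : z * p = p * z by
  rewrite mulrDl mulrDr -cstar_scalerAl -cstar_scalerAr mul1r mulr1.
have pd : p * d = d * p.
  apply: (inverse_of_comm hd); by rewrite pz -zp /z !mulrDl mp addr0.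
have tt : t^-1%:C *: (t%:C *: (1 : A)) = 1.
  by rewrite scalerA -rmorphM /= mulVf ?gt_eqF // scale1r.
split.
  rewrite -cstar_scalerAr mulrBr mulr1 mulrA zp -pz -mulrA hd.1 mulr1.
  by rewrite addrK.
rewrite -cstar_scalerAl mulrBl mul1r pd -mulrA -pz.
by rewrite mulrA -pd -mulrA hd.2 mulr1 addrK.
Qed.

(** The element y = 1 - r with y^2 = 1 - v^2 = s^2 plays the role of |s|. It commutes with s, so (y
    + s)/2 and (y - s)/2 have product (y^2 - s^2)/4 = 0. *)
Lemma orthogonal_parts s v : s * v = v * s -> s * s + v * v = 1 ->
  rnorm s <= 1 -> rnorm v <= 1 ->
  exists p m, [/\ p - m = s, p * m = 0 /\ m * p = 0, rnorm m <= 3 / 2,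
    forall t, 0 < t -> exists d, inverse_of (t%:C *: (1 : A) + p) d &
    exists2 d, inverse_of (1 + m) d & rnorm d <= 5 / 2].
Proof.
move=> sv sq s1 v1.
have vv1 : rnorm (v * v) <= 1.
  by have := rnormM v v; have := rnorm_ge0 v; nra.
have [r [rr r1 rc]] := sqrt_one_sub vv1; set y := 1 - r in rr.
have yE : y = 1 - r by []; clearbody y.
have ys : y * s = s * y.
  by rewrite yE mulrBl mulrBr mul1r mulr1 rc // mulrA sv -mulrA sv mulrA.
have yy : y * y = s * s by rewrite rr -sq addrK.
pose p := (2^-1)%:C *: (y + s); pose m := (2^-1)%:C *: (y - s).
have pm : p * m = 0.
  rewrite /p /m -cstar_scalerAl -cstar_scalerAr mulrBr !mulrDl yy ys.
  by rewrite opprD addrA addrK subrr !scaler0.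
have mp : m * p = 0.
  rewrite /p /m -cstar_scalerAl -cstar_scalerAr mulrDr !mulrBl yy ys.
  by rewrite addrA subrK subrr !scaler0.
have pDm : p + m = y by
  rewrite /p /m -scalerDr addrACA subrr addr0 scalerDr half_scaleD.
(* Since t + y = (t + 1) - r and |r| <= 1, the Neumann gap is at least t. *)
have yinv t : 0 < t -> exists2 d,
  inverse_of (t%:C *: (1 : A) + y) d & rnorm d <= t^-1.
  move=> t0; have [|d hd dt] := @neumann _ _ (t + 1) r; first by lra.
  exists d; last first.
    apply: le_trans dt _; rewrite lef_pV2 ?posrE //; lra.
  suff -> : t%:C *: (1 : A) + y = (t + 1)%:C *: (1 : A) - r by [].
  by rewrite rmorphD scalerDl scale1r yE addrA.
have m32 : rnorm m <= 3 / 2.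
  rewrite /m rnormZr gtr0_norm ?invr_gt0 //.
  by have := rnormB y s; have := rnormB 1 r; have := rnorm1 (A := A);
    rewrite -yE; lra.
exists p, m; split => //.
- by rewrite /p /m -scalerBr opprB addrC addrA subrK scalerDr half_scaleD.
- move=> t t0; have [d hd _] := yinv t t0; rewrite -pDm in hd.
  by eexists; apply: inverse_of_scalar_addl hd.
have [d hd d1] := yinv 1 ltr01; rewrite -pDm (addrC p) in hd.
have := inverse_of_scalar_addl ltr01 mp pm hd; rewrite invr1 !scale1r => hm.
(* The bound 5/2 is 1 + |m| |d| with |m| <= 3/2 and |d| <= 1. *)
exists (1 - m * d) => //; rewrite invr1 in d1.
have := rnormB 1 (m * d); have := rnormM m d; have := rnorm1 (A := A).
by have := rnorm_ge0 m; nra.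
Qed.

(** The pair z, b is fixed before t, so t may later depend on an element y obtained from that
    pair. *)
Lemma cutoff x (eta : R) : 0 < eta -> exists z b, z * x + b = 1 /\
  forall t, 0 < t -> exists k k', [/\ inverse_of k k',
    rnorm (x - x * k) <= 5 / 2 * (eta + t * rnorm x) &
    rnorm (b * k) <= 15 / 4 * t].
Proof.
move=> eta0; pose e := eta ^+ 2 / 2; have e0 : 0 < e
  by rewrite divr_gt0 ?exprn_gt0.
have [h hE hh] : exists2 h : A, star x * x = e%:C *: h & star h = h.
  exists (e^-1%:C *: (star x * x)); last by rewrite starZr starM starK.
  by rewrite scalerA -rmorphM /= divff ?gt_eqF // scale1r.
have [g hg] := add1_sqr_invertible hh.
have hhC : h * (1 + h * h) = (1 + h * h) * h by
  rewrite mulrDr mulrDl mul1r mulr1 mulrA.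
have hgC : h * g = g * h by apply: inverse_of_comm hg hhC.
have sg : star g = g.
  have [h1 h2] : inverse_of (1 + h * h) (star g).
    have [h1 h2] := hg; have e1 : star (1 + h * h) = 1 + h * h
      by rewrite starD star1 starM hh.
    by split; rewrite -{1}e1 -starM ?h1 ?h2 star1.
  by rewrite -[LHS]mulr1 -hg.1 mulrA h2 mul1r.
(* G is 2 / (1 + h^2); then 1 - G and h G are the rational parametrization of the circle. *)
have [G GE] : exists G, G = g + g by eexists.
have sG : star G = G by rewrite GE starD sg.
have hG : h * G = G * h by rewrite GE mulrDr mulrDl hgC.
have GG : G + h * h * G = 1 + 1.
  by rewrite -[X in X + _]mul1r -mulrDl GE mulrDr hg.1.
pose s := 1 - G; pose v := h * G.
have ss : star s = s by rewrite starB star1 sG.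
have vs : star v = v by rewrite starM sG hh.
have Gv : G * v = v * G by rewrite /v mulrA hG.
have sv : s * v = v * s by rewrite /s mulrBl mulrBr mul1r mulr1 Gv.
have sq : s * s + v * v = 1.
  have -> : v * v = h * h * G * G by rewrite /v !mulrA -(mulrA h G h) -hG !mulrA.
  have -> : h * h * G * G = G - G * G + G.
    by rewrite addrAC; apply/eqP;
      rewrite eq_sym subr_eq [eqbRHS]addrC -mulrDl GG mulrDl mul1r.
  by rewrite /s mulrBr mulr1 mulrBl mul1r addrA subrK subrK.
have s1 := rnorm_sqrD1 ss vs sv sq.
have v1 : rnorm v <= 1 by apply: (@rnorm_sqrD1 _ _ v s) => //; rewrite addrC.
have [p [m [pm [pm0 mp0] m32 pinv [D' hD D1]]]] := orthogonal_parts sv sq s1 v1.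
(* |x G|^2 = e |G h G| = e |G v| <= 2 e, which dictates e = eta^2 / 2. *)
have xG : rnorm (x * G) <= eta.
  have : rnorm (x * G) ^+ 2 <= eta ^+ 2.
    rewrite -rnorm_starM starM sG mulrA -(mulrA G) hE -cstar_scalerAr
      -cstar_scalerAl.
    rewrite -mulrA -/v rnormZr gtr0_norm //.
    have := rnormM G v; have := rnormB 1 s; have := rnorm1 (A := A).
    have -> : 1 - s = G by rewrite /s opprB addrC subrK.
    have := rnorm_ge0 G; have := rnorm_ge0 v => v0 G0 h1 h2 h3.
    have Gv2 : rnorm (G * v) <= 2 by nra.
    have -> : eta ^+ 2 = e * 2 by rewrite /e; field.
    by rewrite ler_pM2l.
  by rewrite ler_pXn2r ?nnegrE ?rnorm_ge0 // ltW.
have [P' hP] := pinv 1 ltr01; rewrite scale1r in hP.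
(* With b = m, z must satisfy z x = 1 - m. As v h = 2 - G = 1 + s = (1 + p)(1 - m), dividing by 1 +
   p gives z. *)
exists (P' * (v * (e^-1%:C *: star x))), m; split.
  have -> : P' * (v * (e^-1%:C *: star x)) * x = P' * (v * h).
    rewrite -!mulrA; congr (_ * (_ * _)).
    by rewrite -cstar_scalerAl hE scalerA -rmorphM /= mulVf ?gt_eqF // scale1r.
  have -> : v * h = (1 + p) * (1 - m).
    rewrite mulrBr mulr1 mulrDl mul1r pm0 addr0 -addrA pm /s addrA -GG.
    by rewrite /v -mulrA -hG mulrA addrAC subrr add0r.
  by rewrite mulrA hP.2 mul1r subrK.
move=> t t0; have [d hd] := pinv t t0.
exists ((t%:C *: (1 : A) + p) * D'), ((1 + m) * d); split.
- by apply: inverse_ofM => //; apply: inverse_of_sym.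
(* Over the common factor (1 + m)^-1 the difference is x (1 + m - t - p), and 1 - (p - m) = G. *)
- have -> : x - x * ((t%:C *: (1 : A) + p) * D') = (x * G - t%:C *: x) * D'.
    have xE : x = x * ((1 + m) * D') by rewrite hD.1 mulr1.
    rewrite {1}xE -mulrBr -mulrBl mulrA; congr (_ * _).
    have -> : 1 + m - (t%:C *: (1 : A) + p) = G - t%:C *: (1 : A).
      have -> : G = 1 - (p - m) by rewrite pm /s opprB addrC subrK.
      by rewrite opprB opprD [- (_ *: _) - p]addrC !addrA.
    by rewrite mulrBr -cstar_scalerAr mulr1.
  apply: le_trans (rnormM _ _) _.
  have := rnormB (x * G) (t%:C *: x); rewrite rnormZr (gtr0_norm t0).
  have := rnorm_ge0 (x * G - t%:C *: x); have := rnorm_ge0 D'; nra.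
(* Orthogonality leaves m (t + p) = t m, so the factor t survives. *)
rewrite mulrA mulrDr mp0 addr0 -cstar_scalerAr mulr1 -cstar_scalerAl rnormZr
  gtr0_norm //.
have := rnormM m D'; have := rnorm_ge0 m; have := rnorm_ge0 D'.
have : rnorm m * rnorm D' <= 3 / 2 * (5 / 2) by apply: ler_pM; rewrite ?rnorm_ge0.
nra.
Qed.

Lemma closure_rnormP (S : set A) x :
  closure S x <-> forall e, 0 < e -> exists2 u, S u & rnorm (x - u) < e.
Proof.
split=> [cl e e0|H B /nbhs_ballP[eps /= eps0 epsB]].
  have /cl[u [Su]] : nbhs x (ball x e%:C) by apply: nbhsx_ballx; rewrite ltcR.
  by rewrite -ball_normE /= rnormE ltcR; exists u.
have epsE : eps = (complex.Re eps)%:C by rewrite RRe_real ?gtr0_real.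
have [|u Su xu] := H (complex.Re eps); first by rewrite -ltcR -epsE.
by exists u; split => //; apply: epsB; rewrite -ball_normE /= epsE rnormE ltcR.
Qed.

End Parts.

Theorem proposition9p1 (R : realType) (A : cstarAlgType R) (x : A) :
  closure (quasi_invertible A) x <-> ring_cl (quasi_invertible A) x.
Proof.
rewrite closure_rnormP; split=> [H z b zxb|H e e0].
  have z1 : 0 < rnorm z + 1 by have := rnorm_ge0 z; lra.
  have [|u Qu xu] := H (rnorm z + 1)^-1; first by rewrite invr_gt0.
  have w1 : rnorm ((x - u) * z) < 1.
    apply: le_lt_trans (rnormM _ _) _.
    move: xu; rewrite -[_^-1]mul1r ltr_pdivlMr //; have := rnorm_ge0 (x - u); nra.
  have [v' hv _] := neumann w1; rewrite scale1r in hv.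
  (* Multiplying u = (1 - (x - u) z) x - (x - u) b by [v'] gives x + y b for this y. *)
  exists (- (v' * (x - u))).
  suff -> : x + - (v' * (x - u)) * b = v' * u.
    by apply: quasi_invertibleMl Qu; apply: inverse_of_sym hv.
  have uE : u = (1 - (x - u) * z) * x - (x - u) * b.
    rewrite mulrBl mul1r -addrA -opprD -!mulrA -mulrDr zxb mulr1 opprB addrC.
    by rewrite subrK.
  have -> : v' * u = x - v' * ((x - u) * b).
    by rewrite {1}uE mulrBr [v' * (_ * x)]mulrA hv.2 mul1r.
  by rewrite mulNr mulrA.
have [|z [b [zb cut]]] := @cutoff _ _ x (e / 10); first lra.
have [y Qu] := H z b zb.
(* The error is at most 5/2 (e/10 + t |x|) + 15/4 t |y|; as t (|x| + |y|) <= e/10, this is at most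
   5e/8. *)
pose t := e / (10 * (1 + rnorm x + rnorm y)).
have n0 : 0 < 1 + rnorm x + rnorm y by have := rnorm_ge0 x;
  have := rnorm_ge0 y; lra.
have t0 : 0 < t by rewrite divr_gt0 // mulr_gt0.
have tE : t * (1 + rnorm x + rnorm y) = e / 10 by rewrite /t; field;
  rewrite gt_eqF.
have [k [k' [hk xk bk]]] := cut t t0.
exists ((x + y * b) * k); first exact: quasi_invertibleMr hk Qu.
have -> : x - (x + y * b) * k = (x - x * k) - y * (b * k).
  by rewrite mulrDl opprD addrA mulrA.
have := rnormB (x - x * k) (y * (b * k)); have := rnormM y (b * k).
have : rnorm y * rnorm (b * k) <= rnorm y * (15 / 4 * t) by
  rewrite ler_wpM2l ?rnorm_ge0.
have := mulr_ge0 (ltW t0) (rnorm_ge0 x); have := mulr_ge0 (ltW t0) (rnorm_ge0 y).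
nra.
Qed.
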